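(* Let $\theta>0$ be fixed. There is a constant $C=C(\theta)>0$, depending only on $\theta$, such that for every function $f(z)=\sum_{m=0}^{\infty}a_mz^m$ (with complex coefficients) analytic in $|z|<1$ and every integer $n\ge 1$, $$ \left|\frac{1}{\binom{n+\theta-1}{n}}\sum_{k=0}^n a_k\binom{n-k+\theta-1}{n-k}-f(e^{-1/n})-\frac{S_{\theta}(f;n)}{n\binom{n+\theta-1}{n}}\right| \le C\left(\frac{1}{n}\sum_{j=1}^{\infty}\frac{|S_{\theta}(f;j)|}{j^{\theta}}e^{-j/n}+\frac{1}{n^{\theta}}\sum_{j=n}^{\infty}\frac{|S_{\theta}(f;j)|}{j}e^{-j/n}\right), $$ where for $j\ge 1$ $$ S_{\theta}(f;j)=\sum_{k=1}^{j}k\,a_k\binom{j-k+\theta-1}{j-k}. $$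
   Context: For real $\theta$ and an integer $m\ge 0$, $\binom{m+\theta-1}{m}=\frac{\theta(\theta+1)\cdots(\theta+m-1)}{m!}$ (equal to $1$ for $m=0$) is the generalized binomial coefficient, i.e. the coefficient of $z^m$ in the Taylor expansion of $(1-z)^{-\theta}$ at $0$. *)

(* Defs.v *)
From Stdlib Require Import Arith Reals.
From Coquelicot Require Import Coquelicot.
Open Scope R_scope.

Fixpoint rising (theta : R) (m : nat) : R :=
  match m with
  | O => 1
  | S m' => rising theta m' * (theta + INR m')
  end.

(* "m + theta - 1 choose m": the z^m coefficient of (1 - z)^(-theta). *)
Definition gbinom (theta : R) (m : nat) : R := rising theta m / INR (fact m).

(* [f] is the sum of the complex power series with coefficients [a] at every
   point of the open unit disc; convergence there is part of the predicate. *)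
Definition analytic_in_disc (a : nat -> C) (f : C -> C) : Prop :=
  forall z : C, Cmod z < 1 ->
    @is_pseries C_AbsRing C_NormedModule a z (f z).

Definition Stheta (theta : R) (a : nat -> C) (j : nat) : C :=
  @sum_n_m C_AbelianGroup
    (fun k => (RtoC (INR k) * a k * RtoC (gbinom theta (j - k)))%C) 1 j.

Definition cesaro_mean (theta : R) (a : nat -> C) (n : nat) : C :=
  (RtoC (/ gbinom theta n) *
   @sum_n_m C_AbelianGroup
     (fun k => a k * RtoC (gbinom theta (n - k))) 0 n)%C.

(* Sum of u_j over j >= m, total like [Series]. The nonnegative series it is
   applied to converge, since the Stheta theta a j grow subexponentially when
   the power series of a converges in the unit disc. *)
Definition Series_from (m : nat) (u : nat -> R) : R :=
  Series (fun i => u (m + i)%nat).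

(* Main.v *)
(* Write A_m for the coefficients of (1-z)^(-theta), S_j for S_theta(f; j) and
   tau_n for the Cesaro mean minus S_n / (n A_n). Then
     tau_(n+1) - tau_n = theta / (n (n + theta) A_n) S_n = S_n B(n),
   where B(j) is the integral of t^(j-1) (1-t)^theta over [0, 1], and
   tau_1 = a_0. On the other hand z f'(z) = (1-z)^theta sum_j S_j z^j, so that
   f(r) - a_0 is the sum of S_j times the integral of the same function over
   [0, r]. Hence tau_n - f(r) is exactly the sum over j < n of S_j times the
   integral over [r, 1], minus the sum over j >= n of S_j times the integral
   over [0, r]; for r = exp(-1/n) these integrals are O(n^(-theta-1)) and
   O(n^(-theta) j^(-1) exp(-j/n)). *)

Require Import Defs.
From Stdlib Require Import Arith Reals Lra Lia.
From Coquelicot Require Import Coquelicot.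
Open Scope R_scope.

(** * Comparison through derivatives, and radii of convergence *)

(** Stands in for integral estimates, with [f'] and [g'] as integrands. The mean value theorem for
    [g - s f] with [s = 1] and [s = -1] yields the two signs of the absolute value. *)
Lemma mean_value_domination (f g f' g' : R -> R) (r : R) :
  0 <= r ->
  (forall t, 0 <= t <= r -> is_derive f t (f' t)) ->
  (forall t, 0 <= t <= r -> is_derive g t (g' t)) ->
  (forall t, 0 <= t <= r -> Rabs (f' t) <= g' t) ->
  Rabs (f r - f 0) <= g r - g 0.
Proof.
  intros hr hf hg hle.
  assert (key : forall s, s = 1 \/ s = -1 -> s * (f r - f 0) <= g r - g 0).
  { intros s hs.
    destruct (MVT_gen (fun t => g t - s * f t) 0 r (fun t => g' t - s * f' t))
      as [c [hc e]].
    - intros t ht. rewrite Rmin_left, Rmax_right in ht by lra.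
      apply (is_derive_minus g (fun t => s * f t)); [apply hg; lra|].
      apply (is_derive_scal f t s), hf; lra.
    - intros t ht. rewrite Rmin_left, Rmax_right in ht by lra.
      apply continuity_pt_filterlim, (ex_derive_continuous (fun t => g t - s * f t)).
      exists (g' t - s * f' t).
      apply (is_derive_minus g (fun t => s * f t)); [apply hg; lra|].
      apply (is_derive_scal f t s), hf; lra.
    - rewrite Rmin_left, Rmax_right in hc by lra.
      assert (0 <= (g' c - s * f' c) * (r - 0)); [|lra].
      apply Rmult_le_pos; [|lra].
      specialize (hle c hc). apply Rabs_le_between in hle.
      destruct hs; subst s; lra. }
  apply Rabs_le; split;
    [specialize (key (-1)) | specialize (key 1)]; lra.
Qed.

(** A radius [c < 1] would leave the midpoint of [c] and 1 outside the disc of convergence, where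
    the terms do not tend to 0. *)
Lemma CV_radius_ge_1 (a : nat -> R) :
  (forall x, 0 <= x < 1 -> ex_pseries a x) -> Rbar_le 1 (CV_radius a).
Proof.
  intros ha. apply Rbar_not_lt_le. intros hlt.
  destruct (CV_radius a) as [c| |] eqn:e; try easy.
  - pose proof (CV_radius_ge_0 a) as h0. rewrite e in h0. simpl in *.
    apply (CV_disk_outside a ((c + 1) / 2)).
    + rewrite e, Rabs_pos_eq; simpl; lra.
    + apply ex_series_lim_0.
      destruct (ha ((c + 1) / 2)) as [l hl]; [lra|].
      exists l. now apply is_pseries_R.
  - pose proof (CV_radius_ge_0 a) as h0. now rewrite e in h0.
Qed.

Lemma lt_CV_radius (a : nat -> R) (x : R) :
  Rbar_le 1 (CV_radius a) -> 0 <= x < 1 -> Rbar_lt (Rabs x) (CV_radius a).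
Proof.
  intros ha hx. apply Rbar_lt_le_trans with (2 := ha).
  rewrite Rabs_pos_eq; simpl; lra.
Qed.

(** * Coefficients and sum of the binomial series *)

Lemma gbinom_S (theta : R) (m : nat) :
  gbinom theta (S m) = gbinom theta m * (theta + INR m) / INR (S m).
Proof.
  unfold gbinom. change (fact (S m)) with (S m * fact m)%nat.
  rewrite mult_INR. simpl rising.
  field. split; [apply INR_fact_neq_0 | apply not_0_INR; lia].
Qed.

Lemma gbinom_0 (theta : R) : gbinom theta 0 = 1.
Proof. unfold gbinom; simpl; field. Qed.

Lemma gbinom_pos (theta : R) (m : nat) : 0 < theta -> 0 < gbinom theta m.
Proof.
  intros ht. induction m as [|m IH]; [rewrite gbinom_0; lra|].
  rewrite gbinom_S. pose proof (pos_INR m).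
  apply Rdiv_lt_0_compat; [apply Rmult_lt_0_compat; lra|].
  apply lt_0_INR; lia.
Qed.

Lemma CV_radius_gbinom (theta : R) :
  0 < theta -> Rbar_le 1 (CV_radius (gbinom theta)).
Proof.
  intros ht.
  rewrite (CV_radius_finite_DAlembert (gbinom theta) 1).
  - simpl; lra.
  - intros n. pose proof (gbinom_pos theta n ht). lra.
  - lra.
  (* The quotient of consecutive coefficients is (theta + m) / (m + 1) = 1 + (theta - 1) / (m +
     1). *)
  - apply is_lim_seq_ext with (fun n => 1 + (theta - 1) * / INR (S n)).
    + intros n. rewrite gbinom_S.
      pose proof (gbinom_pos theta n ht). pose proof (pos_INR n).
      assert (hS : 0 < INR (S n)) by (apply lt_0_INR; lia).
      rewrite Rabs_pos_eq.
      * rewrite S_INR in *. field; lra.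
      * replace (gbinom theta n * (theta + INR n) / INR (S n) / gbinom theta n)
          with ((theta + INR n) / INR (S n)) by (field; lra).
        apply Rdiv_le_0_compat; lra.
    + replace (Finite 1) with (Finite (1 + (theta - 1) * 0)) by (f_equal; ring).
      apply is_lim_seq_plus'; [apply is_lim_seq_const|].
      apply (is_lim_seq_scal_l _ _ 0).
      apply (is_lim_seq_incr_1 (fun n => / INR n)).
      apply (is_lim_seq_inv INR p_infty); [apply is_lim_seq_INR | easy].
Qed.

Lemma is_derive_Rpower_1_minus (alpha t : R) :
  t < 1 ->
  is_derive (fun x => Rpower (1 - x) alpha) t
    (- (alpha * Rpower (1 - t) (alpha - 1))).
Proof.
  intros ht.
  replace (- (alpha * Rpower (1 - t) (alpha - 1)))
    with (scal (-1) (alpha * Rpower (1 - t) (alpha - 1)))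
    by (unfold scal; simpl; unfold mult; simpl; ring).
  apply (is_derive_comp (fun y => Rpower y alpha) (fun x => 1 - x)).
  - apply is_derive_Reals, derivable_pt_lim_power; lra.
  - auto_derive; [easy | ring].
Qed.

Lemma Rpower_1_minus_pred (alpha t : R) :
  t < 1 -> (1 - t) * Rpower (1 - t) (alpha - 1) = Rpower (1 - t) alpha.
Proof.
  intros ht. rewrite <- (Rpower_1 (1 - t)) at 1 by lra.
  rewrite <- Rpower_plus. f_equal; ring.
Qed.

(** By [gbinom_S] the sum A satisfies (1 - t) A' = theta A, so A(t) (1 - t)^theta has derivative
    zero and keeps its value 1 at t = 0. *)
Lemma PSeries_gbinom (theta r : R) :
  0 < theta -> 0 <= r < 1 ->
  PSeries (gbinom theta) r * Rpower (1 - r) theta = 1.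
Proof.
  intros ht hr. set (A := gbinom theta).
  assert (hA : Rbar_le 1 (CV_radius A)) by now apply CV_radius_gbinom.
  assert (ode : forall t, 0 <= t < 1 ->
            (1 - t) * PSeries (PS_derive A) t = theta * PSeries A t).
  { intros t h.
    assert (hd : ex_pseries (PS_derive A) t)
      by now apply ex_pseries_derive, lt_CV_radius.
    rewrite <- (PSeries_scal theta).
    replace ((1 - t) * PSeries (PS_derive A) t)
      with (PSeries (PS_derive A) t - t * PSeries (PS_derive A) t) by ring.
    rewrite <- PSeries_incr_1, <- PSeries_minus; trivial.
    - apply PSeries_ext. intros [|m].
      + unfold PS_minus, PS_plus, PS_opp, PS_incr_1, PS_scal, PS_derive, A.
        rewrite gbinom_S, gbinom_0.
        unfold plus, opp, zero, scal; simpl. unfold mult; simpl. field.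
      + unfold PS_minus, PS_plus, PS_opp, PS_incr_1, PS_scal, PS_derive, A.
        rewrite (gbinom_S theta (S m)).
        unfold plus, opp, zero, scal; simpl plus. unfold mult.
        change (INR (S (S m)) * (gbinom theta (S m) * (theta + INR (S m)) / INR (S (S m)))
          + - (INR (S m) * gbinom theta (S m)) = theta * gbinom theta (S m)).
        field. apply not_0_INR; lia.
    - now apply ex_pseries_incr_1. }
  (* With dominating function 0, the comparison lemma expresses constancy of the product. *)
  pose proof (mean_value_domination
    (fun t => PSeries A t * Rpower (1 - t) theta) (fun _ => 0)
    (fun _ => 0) (fun _ => 0) r) as key.
  cbv beta in key.
  rewrite PSeries_0, (gbinom_0 theta : A 0%nat = 1), Rminus_0_r in key.
  assert (e1 : Rpower 1 theta = 1)
    by (unfold Rpower; rewrite ln_1, Rmult_0_r; apply exp_0).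
  rewrite e1 in key.
  assert (h : Rabs (PSeries A r * Rpower (1 - r) theta - 1 * 1) <= 0 - 0).
  { apply key; try lra.
    - intros t h.
      replace 0 with (PSeries (PS_derive A) t * Rpower (1 - t) theta
        + PSeries A t * (- (theta * Rpower (1 - t) (theta - 1)))).
      + apply (is_derive_mult (PSeries A) (fun x => Rpower (1 - x) theta)).
        * apply is_derive_PSeries, lt_CV_radius; trivial; lra.
        * apply is_derive_Rpower_1_minus; lra.
        * intros; apply Rmult_comm.
      + rewrite <- (Rpower_1_minus_pred theta t) by lra.
        transitivity (Rpower (1 - t) (theta - 1)
          * ((1 - t) * PSeries (PS_derive A) t - theta * PSeries A t)); [ring|].
        rewrite ode by lra. ring.
    - intros; apply (is_derive_const (V := R_NormedModule)).
    - intros. rewrite Rabs_R0; lra. }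
  pose proof (Rabs_pos (PSeries A r * Rpower (1 - r) theta - 1 * 1)).
  assert (e : PSeries A r * Rpower (1 - r) theta - 1 * 1 = 0)
    by (apply Rabs_eq_0; lra).
  lra.
Qed.

(** * Incomplete beta integrals *)

(* [beta_tail theta i x] is the integral of t^i (1-t)^theta over [x, 1]; the
   recurrence comes from integrating (t^(i+1) (1-t)^(theta+1))'. *)
Fixpoint beta_tail (theta : R) (i : nat) (x : R) : R :=
  match i with
  | O => Rpower (1 - x) (theta + 1) / (theta + 1)
  | S i' => (INR i * beta_tail theta i' x + x ^ i * Rpower (1 - x) (theta + 1))
            / (INR i + theta + 1)
  end.

Lemma beta_tail_S (theta : R) (i : nat) (x : R) :
  beta_tail theta (S i) x
  = (INR (S i) * beta_tail theta i x + x ^ S i * Rpower (1 - x) (theta + 1))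
    / (INR (S i) + theta + 1).
Proof. reflexivity. Qed.

Lemma is_derive_beta_tail (theta : R) (i : nat) (t : R) :
  0 < theta -> t < 1 ->
  is_derive (beta_tail theta i) t (- (t ^ i * Rpower (1 - t) theta)).
Proof.
  intros htheta ht.
  pose proof (is_derive_Rpower_1_minus (theta + 1) t ht) as hp.
  replace (theta + 1 - 1) with theta in hp by ring.
  (* With this factorization the t^i terms of the induction step cancel; t^(i+1) survives with
     factor -(i + theta + 2), matching the denominator of the recurrence. *)
  assert (ep : Rpower (1 - t) (theta + 1) = (1 - t) * Rpower (1 - t) theta).
  { rewrite <- (Rpower_1_minus_pred (theta + 1)) by lra.
    do 2 f_equal; ring. }
  induction i as [|i IH].
  - apply is_derive_ext with (fun x => / (theta + 1) * Rpower (1 - x) (theta + 1)).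
    { intros; simpl; unfold Rdiv; apply Rmult_comm. }
    replace (- (t ^ 0 * Rpower (1 - t) theta))
      with (/ (theta + 1) * - ((theta + 1) * Rpower (1 - t) theta))
      by (simpl; field; lra).
    now apply (is_derive_scal (fun x => Rpower (1 - x) (theta + 1))).
  - pose proof (pos_INR i).
    apply is_derive_ext with (fun x => / (INR (S i) + theta + 1) *
      (INR (S i) * beta_tail theta i x + x ^ S i * Rpower (1 - x) (theta + 1))).
    { intros; rewrite beta_tail_S; unfold Rdiv; apply Rmult_comm. }
    replace (- (t ^ S i * Rpower (1 - t) theta))
      with (/ (INR (S i) + theta + 1) *
        (INR (S i) * - (t ^ i * Rpower (1 - t) theta)
         + (INR (S i) * t ^ i * Rpower (1 - t) (theta + 1)
            + t ^ S i * - ((theta + 1) * Rpower (1 - t) theta)))).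
    2:{ rewrite ep, S_INR; simpl; field; lra. }
    apply (is_derive_scal (fun x => INR (S i) * beta_tail theta i x
      + x ^ S i * Rpower (1 - x) (theta + 1))).
    apply (is_derive_plus (fun x => INR (S i) * beta_tail theta i x)
      (fun x => x ^ S i * Rpower (1 - x) (theta + 1))).
    + now apply (is_derive_scal (beta_tail theta i)).
    + apply (is_derive_mult (fun x => x ^ S i)
        (fun x => Rpower (1 - x) (theta + 1))); trivial.
      * auto_derive; [easy|].
        rewrite S_INR.
        replace (match i with 0%nat => 1 | S _ => INR i + 1 end) with (INR i + 1)
          by (destruct i; simpl; ring).
        ring.
      * intros; apply Rmult_comm.
Qed.

Lemma beta_tail_nonneg (theta : R) (i : nat) (x : R) :
  0 < theta -> 0 <= x -> 0 <= beta_tail theta i x.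
Proof.
  intros ht hx.
  pose proof (exp_pos ((theta + 1) * ln (1 - x))) as hp.
  fold (Rpower (1 - x) (theta + 1)) in hp.
  induction i as [|i IH].
  - simpl. apply Rdiv_le_0_compat; lra.
  - rewrite beta_tail_S. pose proof (pos_INR (S i)).
    pose proof (pow_le x (S i) hx).
    apply Rdiv_le_0_compat; [|lra].
    apply Rplus_le_le_0_compat; apply Rmult_le_pos; lra.
Qed.

(** The recurrence gives total weight i + 2 to quantities bounded by the right-hand side and divides
    by i + theta + 2. At x = exp(-1/n) this is the O(n^(-theta-1)) used for j < n. *)
Lemma beta_tail_le (theta : R) (i : nat) (x : R) :
  0 < theta -> 0 <= x <= 1 -> beta_tail theta i x <= Rpower (1 - x) (theta + 1).
Proof.
  intros ht hx.
  pose proof (exp_pos ((theta + 1) * ln (1 - x))) as hp.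
  fold (Rpower (1 - x) (theta + 1)) in hp.
  induction i as [|i IH].
  - simpl. apply Rle_div_l; [lra|]. nra.
  - rewrite beta_tail_S. pose proof (pos_INR (S i)).
    apply Rle_div_l; [lra|].
    assert (hle : x ^ S i <= 1) by (rewrite <- (pow1 (S i)); apply pow_incr; lra).
    apply Rle_trans with (INR (S i) * Rpower (1 - x) (theta + 1)
                          + 1 * Rpower (1 - x) (theta + 1)); [|nra].
    apply Rplus_le_compat; [now apply Rmult_le_compat_l|].
    apply Rmult_le_compat_r; lra.
Qed.

(** The Beta value B(i + 1, theta + 1), in the form in which it multiplies S_(i+1) in the increments
    of the corrected mean. *)
Lemma beta_tail_0 (theta : R) (i : nat) :
  0 < theta ->
  beta_tail theta i 0
  = theta / (INR (S i) * (INR (S i) + theta) * gbinom theta (S i)).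
Proof.
  intros ht.
  assert (e1 : Rpower (1 - 0) (theta + 1) = 1)
    by (unfold Rpower; rewrite Rminus_0_r, ln_1, Rmult_0_r; apply exp_0).
  induction i as [|i IH].
  - simpl beta_tail. rewrite e1, gbinom_S, gbinom_0. simpl. field. lra.
  - rewrite beta_tail_S, IH, e1, pow_i by lia.
    rewrite (gbinom_S theta (S i)).
    pose proof (gbinom_pos theta (S i) ht). pose proof (pos_INR i).
    rewrite (S_INR (S i)). rewrite !(S_INR i) in *. field.
    repeat split; lra.
Qed.

Lemma exp_le_compat (x y : R) : x <= y -> exp x <= exp y.
Proof.
  intros [h|<-]; [left; now apply exp_increasing | right; reflexivity].
Qed.

(* With [j = i + 1] and [y = j (r - t)]: the bounds [1 - t <= (1 + y) / n] and
   [(1 + y)^theta <= C exp (y / 2)] show that the integrand decays like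
   [exp (- y / 2)] away from [t = r]. *)
Lemma beta_head_le (theta : R) :
  0 < theta ->
  exists K : R, 0 < K /\
    forall n i : nat, (1 <= n)%nat -> (n <= S i)%nat ->
      Rabs (beta_tail theta i 0 - beta_tail theta i (exp (- (1 / INR n))))
      <= K * (1 / Rpower (INR n) theta
              * (/ INR (S i) * exp (- (INR (S i) / INR n)))).
Proof.
  intros htheta.
  (* From ln v <= v - 1 at v = (1 + y) / (2 theta): (1 + y)^theta <= exp(theta ln(2 theta) + (1 +
     y)/2 - theta); the -theta is dropped. *)
  set (c := exp (theta * ln (2 * theta) + 1 / 2)).
  assert (hc : 0 < c) by apply exp_pos.
  (* The 2 comes from the antiderivative of exp(-y/2), the [exp 2] from replacing the exponent i = j
     - 1 by j in the bound for t^i. *)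
  exists (2 * (c * exp 2)). split.
  { pose proof (exp_pos 2). nra. }
  intros n i hn hni.
  assert (hn1 : 1 <= INR n) by (apply (le_INR 1); lia).
  assert (hnj : INR n <= INR (S i)) by (apply le_INR; lia).
  assert (hinv : 0 < 1 / INR n <= 1).
  { split; [apply Rdiv_lt_0_compat; lra | apply Rle_div_l; lra]. }
  set (j := INR (S i)) in *.
  set (r := exp (- (1 / INR n))).
  assert (hr0 : 0 < r) by apply exp_pos.
  assert (hr1 : r < 1) by (rewrite <- exp_0; apply exp_increasing; lra).
  assert (h1r : 1 - r <= 1 / INR n)
    by (pose proof (exp_ineq1_le (- (1 / INR n))); unfold r; lra).
  set (M := c * exp 2 * (1 / Rpower (INR n) theta) * exp (- (j / INR n))).
  assert (hnp : 0 < Rpower (INR n) theta) by apply exp_pos.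
  assert (hM : 0 < M).
  { unfold M. repeat apply Rmult_lt_0_compat; try apply exp_pos; trivial; try lra.
    now apply Rinv_0_lt_compat. }
  (* [M] collects the factors free of t; the comparison function is an antiderivative of M
     exp(-y/2). *)
  pose proof (mean_value_domination (beta_tail theta i)
    (fun t => M * (2 / j) * exp (- (j * (r - t) / 2)))
    (fun t => - (t ^ i * Rpower (1 - t) theta))
    (fun t => M * exp (- (j * (r - t) / 2))) r) as key.
  cbv beta in key.
  rewrite Rabs_minus_sym. eapply Rle_trans; [apply key|].
  - lra.
  - intros t h. apply is_derive_beta_tail; lra.
  - intros t h. auto_derive; [easy|]. unfold Rminus, Rdiv. field. lra.
  - intros t h.
    assert (hp : 0 < Rpower (1 - t) theta) by apply exp_pos.
    assert (hti : 0 <= t ^ i) by (apply pow_le; lra).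
    rewrite Rabs_Ropp, Rabs_pos_eq by nra.
    assert (hA : Rpower (1 - t) theta
                 <= c * (1 / Rpower (INR n) theta) * exp (j * (r - t) / 2)).
    { assert (hy : 0 <= j * (r - t)) by (apply Rmult_le_pos; lra).
      (* 1 - t = (1 - r) + (r - t) with 1 - r <= 1/n, and n <= j bounds n (r - t) by y. *)
      apply Rle_trans with (Rpower ((1 + j * (r - t)) * / INR n) theta).
      - apply Rle_Rpower_l; [lra|]. split; [lra|].
        apply (Rmult_le_reg_r (INR n)); [lra|].
        rewrite Rmult_assoc, Rinv_l, Rmult_1_r by lra.
        assert ((1 - r) * INR n <= 1)
          by (apply Rle_div_r in h1r; [lra | lra]).
        assert ((r - t) * INR n <= (r - t) * j) by (apply Rmult_le_compat_l; lra).
        lra.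
      - unfold Rpower, c, Rdiv. rewrite !Rmult_1_l, <- exp_Ropp, <- !exp_plus.
        apply exp_le_compat.
        rewrite ln_mult, ln_Rinv by (try apply Rinv_0_lt_compat; lra).
        assert (hl : ln (1 + j * (r - t))
                     <= ln (2 * theta) + ((1 + j * (r - t)) / (2 * theta) - 1)).
        { set (u := (1 + j * (r - t)) / (2 * theta)).
          assert (hu : 0 < u) by (apply Rdiv_lt_0_compat; lra).
          replace (1 + j * (r - t)) with (2 * theta * u) by (unfold u; field; lra).
          rewrite ln_mult by lra.
          pose proof (exp_ineq1_le (ln u)) as hu1. rewrite exp_ln in hu1 by lra. lra. }
        apply (Rmult_le_compat_l theta) in hl; [|lra].
        replace (theta * (ln (2 * theta) + ((1 + j * (r - t)) / (2 * theta) - 1)))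
          with (theta * ln (2 * theta) + (1 + j * (r - t)) / 2 - theta) in hl
          by (field; lra).
        lra. }
    assert (hB : t ^ i <= exp 2 * exp (- (j / INR n)) * exp (- (j * (r - t)))).
    { rewrite <- !exp_plus.
      (* From exp(-(r - t)) >= 1 - (r - t) and r <= 1: r exp(-(r - t)) >= r - (r - t) = t. *)
      assert (hbase : t <= exp (- (1 / INR n) - (r - t))).
      { unfold Rminus at 1. rewrite exp_plus. fold r.
        pose proof (exp_ineq1_le (- (r - t))).
        nra. }
      apply Rle_trans with (exp (- (1 / INR n) - (r - t)) ^ i).
      - apply pow_incr; lra.
      - replace (exp (- (1 / INR n) - (r - t)) ^ i)
          with (exp (INR i * (- (1 / INR n) - (r - t)))).
        (* Passing from i to j costs 1/n + (r - t) <= 2 in the exponent. *)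
        + apply exp_le_compat. unfold j. rewrite S_INR. unfold Rdiv in *.
          assert (r - t <= 1) by lra.
          nra.
        + clear. set (x := _ - _). induction i as [|i IH].
          * simpl. rewrite Rmult_0_l. apply exp_0.
          * rewrite S_INR, <- tech_pow_Rmult, <- IH, <- exp_plus.
            f_equal; ring. }
    apply Rle_trans with
      ((exp 2 * exp (- (j / INR n)) * exp (- (j * (r - t))))
       * (c * (1 / Rpower (INR n) theta) * exp (j * (r - t) / 2))).
    + apply Rmult_le_compat; lra.
    + right.
      replace (exp (- (j * (r - t) / 2)))
        with (exp (- (j * (r - t))) * exp (j * (r - t) / 2))
        by (rewrite <- exp_plus; f_equal; field).
      unfold M. ring.
  - replace (r - r) with 0 by ring.
    replace (- (j * 0 / 2)) with 0 by field. rewrite exp_0.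
    pose proof (exp_pos (- (j * (r - 0) / 2))).
    assert (0 < M * (2 / j)) by (apply Rmult_lt_0_compat; [lra|]; apply Rdiv_lt_0_compat; lra).
    apply Rle_trans with (M * (2 / j)); [nra|].
    right. unfold M. field. split; lra.
Qed.

(** * Termwise integration of the derivative *)

Lemma CV_radius_mult_ge_1 (a b : nat -> R) :
  Rbar_le 1 (CV_radius a) -> Rbar_le 1 (CV_radius b) ->
  Rbar_le 1 (CV_radius (PS_mult a b)).
Proof.
  intros ha hb. apply CV_radius_ge_1. intros x hx.
  apply ex_pseries_mult; now apply lt_CV_radius.
Qed.

Lemma Series_nonneg (u : nat -> R) :
  (forall i, 0 <= u i) -> ex_series u -> 0 <= Series u.
Proof.
  intros h hu. rewrite <- (Rmult_0_l (Series u)), <- Series_scal_l.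
  apply Series_le; trivial. intros i. specialize (h i). lra.
Qed.

(** With T the product of the derivative and the binomial series, the derivative equals T(t) (1 -
    t)^theta; it is integrated over [0, r] term by term. A bound on the remainders, uniform on
    [0, r], justifies the exchange. *)
Lemma beta_expansion (theta : R) (a : nat -> R) (r : R) :
  0 < theta -> Rbar_le 1 (CV_radius a) -> 0 <= r < 1 ->
  is_series (fun i => PS_mult (PS_derive a) (gbinom theta) i
                      * (beta_tail theta i 0 - beta_tail theta i r))
    (PSeries a r - a 0%nat).
Proof.
  intros htheta ha hr.
  set (T := PS_mult (PS_derive a) (gbinom theta)).
  assert (hd : Rbar_le 1 (CV_radius (PS_derive a)))
    by now rewrite CV_radius_derive.
  assert (hA : Rbar_le 1 (CV_radius (gbinom theta)))
    by now apply CV_radius_gbinom.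
  assert (hT : Rbar_le 1 (CV_radius T)) by now apply CV_radius_mult_ge_1.
  assert (habs : forall t, 0 <= t < 1 -> ex_series (fun i => Rabs (T i * t ^ i)))
    by (intros; apply CV_disk_inside; now apply lt_CV_radius).
  assert (hF : forall t, 0 <= t < 1 ->
            PSeries (PS_derive a) t = PSeries T t * Rpower (1 - t) theta).
  { intros t h. unfold T. rewrite PSeries_mult by now apply lt_CV_radius.
    rewrite Rmult_assoc, PSeries_gbinom by easy. ring. }
  (* Remainder at r of the absolutely convergent series T; it dominates the remainder at every t in
     [0, r]. *)
  set (eps := fun N => Series (fun k => Rabs (T (S N + k)%nat * r ^ (S N + k)))).
  assert (heps : is_lim_seq eps 0).
  { apply is_lim_seq_ext with (fun N => Series (fun i => Rabs (T i * r ^ i))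
      - sum_n (fun i => Rabs (T i * r ^ i)) N).
    - intros N. unfold eps. rewrite sum_n_Reals.
      rewrite (Series_incr_n (fun i => Rabs (T i * r ^ i)) (S N)); [|lia|now apply habs].
      simpl pred. lra.
    - replace (Finite 0) with (Finite (Series (fun i => Rabs (T i * r ^ i))
        - Series (fun i => Rabs (T i * r ^ i)))) by (f_equal; ring).
      apply is_lim_seq_minus'; [apply is_lim_seq_const|].
      exact (Series_correct _ (habs r hr)). }
  assert (hbound : forall N,
    Rabs (sum_n (fun i => T i * (beta_tail theta i 0 - beta_tail theta i r)) N
          - (PSeries a r - a 0%nat)) <= eps N).
  { intros N. rewrite sum_n_Reals.
    (* The increment of this function over [0, r] is, up to sign, the error of the N-th partial sum;
       its derivative is (1 - t)^theta times the remainder of T at t. *)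
    pose proof (mean_value_domination
      (fun t => PSeries a t + sum_f_R0 (fun i => T i * beta_tail theta i t) N)
      (fun t => eps N * t)
      (fun t => PSeries (PS_derive a) t
                + sum_f_R0 (fun i => T i * - (t ^ i * Rpower (1 - t) theta)) N)
      (fun _ => eps N) r) as key.
    cbv beta in key. rewrite PSeries_0 in key.
    replace (sum_f_R0 (fun i => T i * (beta_tail theta i 0 - beta_tail theta i r)) N)
      with (sum_f_R0 (fun i => T i * beta_tail theta i 0) N
            - sum_f_R0 (fun i => T i * beta_tail theta i r) N)
      by (rewrite <- minus_sum; apply sum_eq; intros; ring).
    rewrite <- Rabs_Ropp.
    match goal with |- Rabs ?x <= _ => match type of key with
      | _ -> _ -> _ -> _ -> Rabs ?y <= _ => replace x with y by ring end end.
    assert (heps0 : 0 <= eps N).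
    { apply Series_nonneg; [intros; apply Rabs_pos|].
      now apply (ex_series_incr_n (fun i => Rabs (T i * r ^ i))), habs. }
    apply Rle_trans with (eps N * r - eps N * 0); [apply key|nra].
    - lra.
    - intros t h. apply (is_derive_plus (PSeries a)
        (fun t => sum_f_R0 (fun i => T i * beta_tail theta i t) N)).
      + apply is_derive_PSeries, lt_CV_radius; trivial; lra.
      + clear -htheta hr h. induction N as [|N IH].
        * simpl sum_f_R0. apply (is_derive_scal (beta_tail theta 0)).
          apply is_derive_beta_tail; lra.
        * apply (is_derive_plus
            (fun t => sum_f_R0 (fun i => T i * beta_tail theta i t) N)
            (fun t => T (S N) * beta_tail theta (S N) t)); [exact IH|].
          apply (is_derive_scal (beta_tail theta (S N))).
          apply is_derive_beta_tail; lra.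
    - intros t h. auto_derive; [easy | ring].
    - intros t h. rewrite hF by lra.
      replace (sum_f_R0 (fun i => T i * - (t ^ i * Rpower (1 - t) theta)) N)
        with (- Rpower (1 - t) theta * sum_f_R0 (fun i => T i * t ^ i) N)
        by (rewrite scal_sum; apply sum_eq; intros; ring).
      assert (hser : PSeries T t = sum_f_R0 (fun i => T i * t ^ i) N
                + Series (fun k => T (S N + k)%nat * t ^ (S N + k))).
      { unfold PSeries. rewrite (Series_incr_n _ (S N)); [reflexivity|lia|].
        apply ex_series_Rabs, habs; lra. }
      rewrite hser.
      replace (_ + _) with (Rpower (1 - t) theta
        * Series (fun k => T (S N + k)%nat * t ^ (S N + k))) by ring.
      rewrite Rabs_mult, <- (Rmult_1_l (eps N)).
      assert (hp : 0 < Rpower (1 - t) theta) by apply exp_pos.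
      assert (hex : forall x, 0 <= x < 1 ->
        ex_series (fun k => Rabs (T (S N + k)%nat * x ^ (S N + k)))).
      { intros x hx. now apply (ex_series_incr_n (fun i => Rabs (T i * x ^ i))), habs. }
      apply Rmult_le_compat; try apply Rabs_pos.
      + rewrite Rabs_pos_eq by lra.
        apply Rle_trans with (exp 0); [|rewrite exp_0; lra].
        apply exp_le_compat.
        assert (ln (1 - t) <= 0) by (rewrite <- ln_1; apply ln_le; lra). nra.
      + eapply Rle_trans; [apply Series_Rabs, hex; lra|].
        apply Series_le; [|now apply hex]. intros k. split; [apply Rabs_pos|].
        rewrite !Rabs_mult. apply Rmult_le_compat_l; [apply Rabs_pos|].
        rewrite !Rabs_pos_eq by (apply pow_le; lra).
        apply pow_incr; lra. }
  assert (hlim : is_lim_seq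
    (sum_n (fun i => T i * (beta_tail theta i 0 - beta_tail theta i r)))
    (PSeries a r - a 0%nat)); [|exact hlim].
  apply is_lim_seq_ext with (fun N => (PSeries a r - a 0%nat)
    + (sum_n (fun i => T i * (beta_tail theta i 0 - beta_tail theta i r)) N
          - (PSeries a r - a 0%nat))); [intros; ring|].
  replace (Finite (PSeries a r - a 0%nat))
    with (Finite (PSeries a r - a 0%nat + 0)) by (f_equal; ring).
  apply is_lim_seq_plus'; [apply is_lim_seq_const|].
  apply is_lim_seq_abs_0.
  apply is_lim_seq_le_le with (fun _ => 0) eps; trivial.
  - intros N. split; [apply Rabs_pos | apply hbound].
  - apply is_lim_seq_const.
Qed.

(** * Finite sums with strict upper bound *)

(** The empty sum must be available, since for n = 1 there is no index 1 <= j < n; [sum_f_R0] always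
    has a first term. *)
Fixpoint sum_lt (u : nat -> R) (n : nat) : R :=
  match n with
  | O => 0
  | S m => sum_lt u m + u m
  end.

Lemma sum_lt_le (u v : nat -> R) (n : nat) :
  (forall i, (i < n)%nat -> u i <= v i) -> sum_lt u n <= sum_lt v n.
Proof.
  induction n as [|n IH]; intros h; simpl; [lra|].
  apply Rplus_le_compat; [apply IH; intros; apply h; lia | apply h; lia].
Qed.

Lemma Rabs_sum_lt_le (u : nat -> R) (n : nat) :
  Rabs (sum_lt u n) <= sum_lt (fun i => Rabs (u i)) n.
Proof.
  induction n as [|n IH]; simpl; [rewrite Rabs_R0; lra|].
  eapply Rle_trans; [apply Rabs_triang | lra].
Qed.

Lemma sum_lt_scal (c : R) (u : nat -> R) (n : nat) :
  sum_lt (fun i => c * u i) n = c * sum_lt u n.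
Proof. induction n as [|n IH]; simpl; [|rewrite IH]; ring. Qed.

Lemma sum_lt_minus (u v : nat -> R) (n : nat) :
  sum_lt (fun i => u i - v i) n = sum_lt u n - sum_lt v n.
Proof. induction n as [|n IH]; simpl; [|rewrite IH]; ring. Qed.

Lemma Series_sum_lt (u : nat -> R) (n : nat) :
  ex_series u -> Series u = sum_lt u n + Series (fun i => u (n + i)%nat).
Proof.
  intros h. induction n as [|n IH]; simpl; [symmetry; apply Rplus_0_l|].
  rewrite IH, (Series_incr_1 (fun i => u (n + i)%nat))
    by now apply (ex_series_incr_n u).
  rewrite Nat.add_0_r, Rplus_assoc. do 2 f_equal.
  apply Series_ext. intros; f_equal; lia.
Qed.

Lemma sum_lt_le_Series (u : nat -> R) (n : nat) :
  (forall i, 0 <= u i) -> ex_series u -> sum_lt u n <= Series u.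
Proof.
  intros h hu. rewrite (Series_sum_lt u n) by easy.
  assert (0 <= Series (fun i => u (n + i)%nat)); [|lra].
  apply Series_nonneg; [easy | now apply (ex_series_incr_n u)].
Qed.

(** * The corrected Cesaro mean as a sum of beta integrals *)

(* The Cesaro mean corrected by [S_n / (n A_n)], where [A = gbinom theta]. It
   is the Cesaro mean of order [theta + 1] at [n - 1], so its successive
   differences are multiples of [S_n]. *)
Definition corrected_mean (theta : R) (a : nat -> R) (n : nat) : R :=
  sum_f_R0 (fun k => a k * gbinom theta (n - k) * (1 - INR k / INR n)) n
  / gbinom theta n.

(** Index shift: the k = 0 term vanishes by its factor k, so S_(i+1) is coefficient i of a Cauchy
    product. *)
Lemma sum_weighted_PS_mult (theta : R) (a : nat -> R) (i : nat) :
  sum_f_R0 (fun k => INR k * a k * gbinom theta (S i - k)) (S i)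
  = PS_mult (PS_derive a) (gbinom theta) i.
Proof.
  rewrite decomp_sum by lia. simpl INR at 1. rewrite !Rmult_0_l, Rplus_0_l.
  apply sum_eq. intros k hk. unfold PS_derive. now rewrite Nat.sub_succ.
Qed.

Lemma corrected_mean_eq (theta : R) (a : nat -> R) (i : nat) :
  0 < theta ->
  sum_f_R0 (fun k => a k * gbinom theta (S i - k)) (S i) / gbinom theta (S i)
  - PS_mult (PS_derive a) (gbinom theta) i / (INR (S i) * gbinom theta (S i))
  = corrected_mean theta a (S i).
Proof.
  intros ht. unfold corrected_mean. rewrite <- sum_weighted_PS_mult.
  pose proof (gbinom_pos theta (S i) ht).
  assert (0 < INR (S i)) by (apply lt_0_INR; lia).
  rewrite (sum_eq (fun k => a k * gbinom theta (S i - k) * (1 - INR k / INR (S i)))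
    (fun k => a k * gbinom theta (S i - k)
      - INR k * a k * gbinom theta (S i - k) * / INR (S i)) (S i)).
  - rewrite minus_sum, <- scal_sum. field. lra.
  - intros k _. field. lra.
Qed.

Lemma corrected_mean_step (theta : R) (a : nat -> R) (i : nat) :
  0 < theta ->
  corrected_mean theta a (S (S i)) - corrected_mean theta a (S i)
  = PS_mult (PS_derive a) (gbinom theta) i * beta_tail theta i 0.
Proof.
  intros ht. unfold corrected_mean. rewrite <- sum_weighted_PS_mult.
  rewrite beta_tail_0 by easy.
  set (n := S i).
  assert (hn : 0 < INR n) by (apply lt_0_INR; unfold n; lia).
  pose proof (gbinom_pos theta n ht) as hA.
  rewrite tech5.
  (* The weight kills the term k = n + 1, so both means are sums over k <= n and can be compared
     term by term. *)
  replace (1 - INR (S n) / INR (S n)) with 0 by (rewrite S_INR; field; lra).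
  rewrite Rmult_0_r, Rplus_0_r.
  unfold Rdiv at 1 3.
  rewrite (Rmult_comm _ (/ gbinom theta (S n))), (Rmult_comm _ (/ gbinom theta n)).
  rewrite (Rmult_comm _ (theta / _)), !scal_sum, <- minus_sum.
  apply sum_eq. intros k hk.
  rewrite Nat.sub_succ_l by easy.
  rewrite (gbinom_S theta (n - k)), (gbinom_S theta n).
  rewrite (S_INR n), (S_INR (n - k)), minus_INR by easy.
  (* The termwise difference rests on n (n - k + theta) - (n - k) (n + theta) = k theta. *)
  apply le_INR in hk. field. repeat split; lra.
Qed.

Lemma corrected_mean_sum (theta : R) (a : nat -> R) (i : nat) :
  0 < theta ->
  corrected_mean theta a (S i)
  = a 0%nat + sum_lt (fun k => PS_mult (PS_derive a) (gbinom theta) k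
                               * beta_tail theta k 0) i.
Proof.
  intros ht. induction i as [|i IH].
  - unfold corrected_mean. simpl. pose proof (gbinom_pos theta 1 ht).
    field. lra.
  - pose proof (corrected_mean_step theta a i ht). simpl sum_lt. lra.
Qed.

(** Each integral over [0, 1] is split at r. For k < i the parts over [0, r] cancel against the
    expansion of the power series; for k >= i only that expansion contributes. With n = i + 1 and j
    = k + 1, k < i means j < n. *)
Lemma corrected_mean_minus_PSeries (theta r : R) (a : nat -> R) (i : nat) :
  0 < theta -> Rbar_le 1 (CV_radius a) -> 0 <= r < 1 ->
  corrected_mean theta a (S i) - PSeries a r
  = sum_lt (fun k => PS_mult (PS_derive a) (gbinom theta) k
                     * beta_tail theta k r) i
    - Series (fun k => PS_mult (PS_derive a) (gbinom theta) (i + k)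
        * (beta_tail theta (i + k) 0 - beta_tail theta (i + k) r)).
Proof.
  intros ht ha hr.
  pose proof (beta_expansion theta a r ht ha hr) as h.
  pose proof (is_series_unique _ _ h) as e.
  rewrite (Series_sum_lt _ i) in e by now exists (PSeries a r - a 0%nat).
  rewrite corrected_mean_sum by easy.
  set (T := PS_mult (PS_derive a) (gbinom theta)) in *.
  replace (PSeries a r) with (a 0%nat + (PSeries a r - a 0%nat)) by ring.
  rewrite <- e.
  assert (e2 : sum_lt (fun k => T k * beta_tail theta k r) i
    = sum_lt (fun k => T k * beta_tail theta k 0) i
      - sum_lt (fun k => T k * (beta_tail theta k 0 - beta_tail theta k r)) i).
  { rewrite <- sum_lt_minus. clear. induction i as [|i IH]; simpl; lra. }
  rewrite e2. ring.
Qed.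

(** * The estimate for real coefficients *)

Lemma Rpower_ge_1 (x alpha : R) : 1 <= x -> 0 <= alpha -> 1 <= Rpower x alpha.
Proof.
  intros hx ha. rewrite <- exp_0. unfold Rpower. apply exp_le_compat.
  apply Rmult_le_pos; trivial. rewrite <- ln_1. apply ln_le; lra.
Qed.

(** The majorant [u] is kept apart from [a] so that the modulus of a complex S_j can serve for its
    real and imaginary parts alike. Its convergence hypothesis makes each [Series_from] a genuine
    sum. *)
Lemma real_bound (theta : R) :
  0 < theta ->
  exists K : R, 0 < K /\
    forall (a : nat -> R) (u : nat -> R),
      Rbar_le 1 (CV_radius a) ->
      (forall i, Rabs (PS_mult (PS_derive a) (gbinom theta) i) <= u (S i)) ->
      (forall x, 0 <= x < 1 -> ex_series (fun i => u (S i) * x ^ i)) ->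
      forall n : nat, (1 <= n)%nat ->
      Rabs (corrected_mean theta a n - PSeries a (exp (- (1 / INR n))))
      <= K * (1 / INR n *
                Series_from 1 (fun j => u j / Rpower (INR j) theta
                  * exp (- (INR j / INR n)))
              + 1 / Rpower (INR n) theta *
                Series_from n (fun j => u j / INR j
                  * exp (- (INR j / INR n)))).
Proof.
  intros htheta. destruct (beta_head_le theta htheta) as [K [hK hhead]].
  pose proof (exp_pos 1) as he.
  (* [exp 1] compensates the factor exp(-j/n) in the terms with j < n; [K] handles j >= n. *)
  exists (exp 1 + K). split; [lra|].
  intros a u ha hTu hu n hn.
  destruct n as [|N]; [lia|]. set (n := S N) in *.
  assert (hn1 : 1 <= INR n) by (apply (le_INR 1); lia).
  assert (hinv : 0 < 1 / INR n).
  { apply Rdiv_lt_0_compat; lra. }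
  assert (hnp : 0 < Rpower (INR n) theta) by apply exp_pos.
  set (r := exp (- (1 / INR n))).
  assert (hr : 0 <= r < 1).
  { split; [left; apply exp_pos|]. rewrite <- exp_0; apply exp_increasing; lra. }
  assert (hu0 : forall i, 0 <= u (S i))
    by (intros i; eapply Rle_trans; [apply Rabs_pos | apply hTu]).
  (* One power of r is given up to match the hypothesis on [u], which pairs u_(i+1) with x^i. *)
  assert (hexp : forall i, exp (- (INR (S i) / INR n)) <= r ^ i).
  { intros i. apply Rle_trans with (r ^ S i).
    - right. unfold r. clear -hn1. induction i as [|i IH].
      + simpl. rewrite Rmult_1_r. f_equal; field; lra.
      + rewrite <- tech_pow_Rmult, <- IH, <- exp_plus. f_equal.
        rewrite (S_INR (S i)). field; lra.
    - simpl. pose proof (pow_le r i (proj1 hr)). nra. }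
  set (v := fun j => u j / Rpower (INR j) theta * exp (- (INR j / INR n))).
  set (w := fun j => u j / INR j * exp (- (INR j / INR n))).
  assert (hS1 : forall i, 1 <= INR (S i)) by (intros; apply (le_INR 1); lia).
  (* Both weights, j^theta and j, are at least 1, so one comparison covers both series. *)
  assert (hcomp : forall (d : nat -> R), (forall i, 1 <= d (S i)) -> forall i,
    0 <= u (S i) / d (S i) * exp (- (INR (S i) / INR n)) <= u (S i) * r ^ i).
  { intros d hd i. specialize (hd i). specialize (hu0 i). specialize (hexp i).
    pose proof (exp_pos (- (INR (S i) / INR n))) as hep.
    assert (h1 : 0 <= u (S i) / d (S i)) by (apply Rdiv_le_0_compat; lra).
    split; [apply Rmult_le_pos; lra|].
    apply Rmult_le_compat; try lra.
    apply Rle_div_l; [lra|]. nra. }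
  pose proof (hcomp (fun j => Rpower (INR j) theta)
    (fun i => Rpower_ge_1 _ theta (hS1 i) (Rlt_le _ _ htheta))) as hv.
  pose proof (hcomp INR hS1) as hw.
  assert (hvs : ex_series (fun i => v (S i))).
  { apply (ex_series_le (V := R_CompleteNormedModule) _ (fun i => u (S i) * r ^ i));
      [|now apply hu].
    intros i. change (Rabs (v (S i)) <= u (S i) * r ^ i).
    unfold v. rewrite Rabs_pos_eq; apply hv. }
  assert (hws : ex_series (fun i => w (S i))).
  { apply (ex_series_le (V := R_CompleteNormedModule) _ (fun i => u (S i) * r ^ i));
      [|now apply hu].
    intros i. change (Rabs (w (S i)) <= u (S i) * r ^ i).
    unfold w. rewrite Rabs_pos_eq; apply hw. }
  assert (hwn : ex_series (fun i => w (n + i)%nat))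
    by exact (proj1 (ex_series_incr_n (fun i => w (S i)) N) hws).
  unfold Series_from, n at 1.
  rewrite corrected_mean_minus_PSeries by easy.
  set (T := PS_mult (PS_derive a) (gbinom theta)) in *.
  assert (h1 : Rabs (sum_lt (fun k => T k * beta_tail theta k r) N)
    <= exp 1 * (1 / INR n * Series (fun i => v (1 + i)%nat))).
  { rewrite <- Rmult_assoc.
    eapply Rle_trans; [apply Rabs_sum_lt_le|].
    apply Rle_trans with (sum_lt (fun i => exp 1 * (1 / INR n) * v (S i)) N).
    2:{ rewrite sum_lt_scal. apply Rmult_le_compat_l; [nra|].
        apply (sum_lt_le_Series (fun i => v (S i))); trivial.
        intros i. apply hv. }
    apply sum_lt_le. intros i hi.
    rewrite Rabs_mult, (Rabs_pos_eq (beta_tail theta i r))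
      by (apply beta_tail_nonneg; lra).
    assert (hin : INR (S i) <= INR n) by (apply le_INR; unfold n; lia).
    specialize (hS1 i).
    assert (hip : 0 < Rpower (INR (S i)) theta) by apply exp_pos.
    (* 1 - r <= 1/n gives n^(-theta-1), and j <= n gives n^(-theta) <= j^(-theta). *)
    assert (hb : beta_tail theta i r <= 1 / INR n * (1 / Rpower (INR (S i)) theta)).
    { eapply Rle_trans; [apply beta_tail_le; lra|].
      apply Rle_trans with (Rpower (/ INR n) (theta + 1)).
      - apply Rle_Rpower_l; [lra|]. split; [lra|].
        pose proof (exp_ineq1_le (- (1 / INR n))). unfold r. lra.
      - rewrite Rpower_plus, Rpower_1, Rmult_comm by (apply Rinv_0_lt_compat; lra).
        unfold Rdiv. rewrite !Rmult_1_l.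
        apply Rmult_le_compat_l; [lra|].
        replace (Rpower (/ INR n) theta) with (/ Rpower (INR n) theta).
        2:{ unfold Rpower. rewrite ln_Rinv, <- exp_Ropp by lra. f_equal; ring. }
        apply Rinv_le_contravar; trivial.
        apply Rle_Rpower_l; lra. }
    assert (hE : 1 <= exp 1 * exp (- (INR (S i) / INR n))).
    { rewrite <- exp_plus. apply Rle_trans with (exp 0); [rewrite exp_0; lra|].
      apply exp_le_compat.
      assert (INR (S i) / INR n <= 1) by (apply Rle_div_l; lra). lra. }
    apply Rle_trans with (u (S i) * (1 / INR n * (1 / Rpower (INR (S i)) theta))).
    - apply Rmult_le_compat; trivial; [apply Rabs_pos|].
      apply beta_tail_nonneg; lra.
    - set (q := u (S i) * (1 / INR n * (1 / Rpower (INR (S i)) theta))).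
      assert (0 <= q).
      { unfold q. specialize (hu0 i).
        assert (0 < 1 / Rpower (INR (S i)) theta) by (apply Rdiv_lt_0_compat; lra).
        apply Rmult_le_pos; trivial. apply Rmult_le_pos; lra. }
      replace (exp 1 * (1 / INR n) * v (S i))
        with (q * (exp 1 * exp (- (INR (S i) / INR n))))
        by (unfold q, v; field; lra).
      nra. }
  assert (h2 : Rabs (Series (fun k => T (N + k)%nat
      * (beta_tail theta (N + k) 0 - beta_tail theta (N + k) r)))
    <= K * (1 / Rpower (INR n) theta * Series (fun i => w (n + i)%nat))).
  { rewrite <- Rmult_assoc, <- Series_scal_l.
    assert (hex : ex_series (fun k => K * (1 / Rpower (INR n) theta) * w (n + k)%nat))
      by now apply (ex_series_scal_l (K * (1 / Rpower (INR n) theta))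
                      (fun k => w (n + k)%nat)).
    assert (hle : forall k, Rabs (T (N + k)%nat
      * (beta_tail theta (N + k) 0 - beta_tail theta (N + k) r))
      <= K * (1 / Rpower (INR n) theta) * w (n + k)%nat).
    { intros k. rewrite Rabs_mult.
      change (n + k)%nat with (S (N + k)).
      apply Rle_trans with (u (S (N + k)) * (K * (1 / Rpower (INR n) theta
        * (/ INR (S (N + k)) * exp (- (INR (S (N + k)) / INR n)))))).
      - apply Rmult_le_compat; try apply Rabs_pos; trivial.
        apply hhead; unfold n; lia.
      - right. unfold w. unfold Rdiv. ring. }
    eapply Rle_trans; [apply Series_Rabs|].
    - apply (ex_series_le (V := R_CompleteNormedModule)
        _ (fun k => K * (1 / Rpower (INR n) theta) * w (n + k)%nat)); trivial.
      intros k. unfold norm; simpl. unfold abs; simpl. rewrite Rabs_Rabsolu. apply hle.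
    - apply Series_le; trivial. intros; split; [apply Rabs_pos | apply hle]. }
  (* Both bounds being nonnegative, each may carry the common constant [exp 1 + K]. *)
  assert (hv0 : 0 <= 1 / INR n * Series (fun i => v (1 + i)%nat)).
  { apply Rmult_le_pos; [lra|]. apply Series_nonneg; trivial. intros; apply hv. }
  assert (hw0 : 0 <= 1 / Rpower (INR n) theta * Series (fun i => w (n + i)%nat)).
  { apply Rmult_le_pos; [apply Rdiv_le_0_compat; lra|].
    apply Series_nonneg; trivial. intros; apply hw. }
  eapply Rle_trans; [apply Rabs_triang|]. rewrite Rabs_Ropp.
  rewrite Rmult_plus_distr_l, !Rmult_plus_distr_r.
  assert (0 <= K * (1 / INR n * Series (fun i => v (1 + i)%nat)))
    by (apply Rmult_le_pos; lra).
  assert (0 <= exp 1 * (1 / Rpower (INR n) theta * Series (fun i => w (n + i)%nat)))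
    by (apply Rmult_le_pos; lra).
  lra.
Qed.

(** * Passage from complex to real coefficients *)

(** Properties shared by [Re] and [Im], so that each transfer is proved once; the modulus bound
    carries limits across. *)
Definition real_functional (p : C -> R) : Prop :=
  (forall x y : C, p (x + y)%C = p x + p y) /\
  (forall (x : C) (c : R), p (x * RtoC c)%C = p x * c) /\
  (forall x : C, Rabs (p x) <= Cmod x).

Lemma real_functional_Re : real_functional Re.
Proof.
  split; [|split]; [| |apply re_le_Cmod]; intros; unfold Re; simpl; ring.
Qed.

Lemma real_functional_Im : real_functional Im.
Proof.
  split; [|split]; intros x; [intros; unfold Im; simpl; ring..|].
  eapply Rle_trans; [|apply Rmax_Cmod]. apply Rmax_r.
Qed.

Lemma Cmod_le_Re_Im (z : C) : Cmod z <= Rabs (Re z) + Rabs (Im z).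
Proof.
  destruct z as [x y]. simpl.
  replace (x, y) with (RtoC x + Ci * RtoC y)%C
    by (unfold RtoC, Ci, Cplus, Cmult; simpl; f_equal; ring).
  eapply Rle_trans; [apply Cmod_triangle|].
  rewrite Cmod_mult, !Cmod_R.
  replace (Cmod Ci) with 1; [lra|].
  unfold Cmod; simpl. replace (_ + _) with 1 by ring. now rewrite sqrt_1.
Qed.

Lemma real_functional_opp (p : C -> R) (x : C) :
  real_functional p -> p (- x)%C = - p x.
Proof.
  intros [_ [hs _]]. replace (- x)%C with (x * RtoC (-1))%C.
  - rewrite hs; ring.
  - destruct x; unfold RtoC, Copp, Cmult; simpl; f_equal; ring.
Qed.

Lemma real_functional_minus (p : C -> R) (x y : C) :
  real_functional p -> p (x - y)%C = p x - p y.
Proof.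
  intros hp. pose proof (real_functional_opp p y hp) as ho.
  destruct hp as [ha _]. unfold Cminus. rewrite ha, ho. ring.
Qed.

Lemma real_functional_sum_n (p : C -> R) (u : nat -> C) (n : nat) :
  real_functional p ->
  p (@sum_n C_AbelianGroup u n) = sum_f_R0 (fun k => p (u k)) n.
Proof.
  intros [ha _]. induction n as [|n IH].
  - now rewrite sum_O.
  - rewrite sum_Sn, tech5, <- IH. apply ha.
Qed.

(** At a real point the powers of x are real scalars, which [p] lets through; the modulus bound then
    preserves convergence of the partial sums. *)
Lemma real_functional_pseries (p : C -> R) (a : nat -> C) (x : R) (l : C) :
  real_functional p ->
  @is_pseries C_AbsRing C_NormedModule a (RtoC x) l ->
  is_pseries (fun k => p (a k)) x (p l).
Proof.
  intros hp h. apply is_pseries_R.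
  apply filterlim_locally_ball_norm. intros eps.
  generalize (proj1 (filterlim_locally_ball_norm _ l) h eps).
  apply filter_imp. intros n hn. unfold ball_norm in *.
  eapply Rle_lt_trans; [|exact hn].
  rewrite sum_n_Reals.
  set (z := sum_n _ n).
  replace (sum_f_R0 (fun k => p (a k) * x ^ k) n) with (p z).
  - change (Rabs (p z - p l) <= Cmod (z - l)%C).
    rewrite <- real_functional_minus by easy. now apply hp.
  - unfold z. rewrite real_functional_sum_n by easy.
    apply sum_eq. intros k _.
    destruct hp as [_ [hs _]]. rewrite <- hs. f_equal.
    change (Cmult (@pow_n C_Ring (RtoC x) k) (a k) = Cmult (a k) (RtoC (x ^ k))).
    rewrite Cmult_comm. f_equal. clear.
    induction k as [|k IH]; [reflexivity|].
    simpl pow_n. rewrite IH. simpl pow. rewrite RtoC_mult. reflexivity.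
Qed.

Lemma Stheta_real_functional (p : C -> R) (theta : R) (a : nat -> C) (i : nat) :
  real_functional p ->
  p (Stheta theta a (S i))
  = PS_mult (PS_derive (fun k => p (a k))) (gbinom theta) i.
Proof.
  intros hp. unfold Stheta.
  (* Reindexing 1..i+1 as 0..i matches the shift in [PS_derive]. *)
  rewrite <- sum_n_m_S.
  change (p (@sum_n C_AbelianGroup (fun k => (RtoC (INR (S k)) * a (S k)
    * RtoC (gbinom theta (S i - S k)))%C) i) = PS_mult (PS_derive (fun k => p (a k))) (gbinom theta) i).
  rewrite real_functional_sum_n by easy. unfold PS_mult, PS_derive.
  destruct hp as [_ [hs _]].
  apply sum_eq. intros k _. rewrite hs, Cmult_comm, hs, Nat.sub_succ. ring.
Qed.

Lemma corrected_mean_real_functional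
  (p : C -> R) (theta : R) (a : nat -> C) (n : nat) :
  real_functional p -> 0 < theta -> (1 <= n)%nat ->
  p (cesaro_mean theta a n - Stheta theta a n / RtoC (INR n * gbinom theta n))%C
  = corrected_mean theta (fun k => p (a k)) n.
Proof.
  intros hp ht hn. destruct n as [|i]; [lia|].
  assert (hA : 0 < gbinom theta (S i)) by now apply gbinom_pos.
  assert (hn0 : 0 < INR (S i)) by (apply lt_0_INR; lia).
  rewrite <- corrected_mean_eq, <- Stheta_real_functional by easy.
  rewrite real_functional_minus by easy. unfold cesaro_mean, Cdiv.
  rewrite (Cmult_comm (RtoC (/ _))), <- RtoC_inv by (apply Rgt_not_eq; nra).
  fold (@sum_n C_AbelianGroup (fun k => (a k * RtoC (gbinom theta (S i - k)))%C) (S i)).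
  pose proof (real_functional_sum_n p
    (fun k => (a k * RtoC (gbinom theta (S i - k)))%C) (S i) hp) as e.
  destruct hp as [_ [hs _]]. rewrite !hs, e. unfold Rdiv.
  f_equal. f_equal. apply sum_eq. intros; apply hs.
Qed.

Lemma CV_radius_real_functional (p : C -> R) (a : nat -> C) (f : C -> C) :
  real_functional p -> analytic_in_disc a f ->
  Rbar_le 1 (CV_radius (fun k => p (a k))).
Proof.
  intros hp ha. apply CV_radius_ge_1. intros x hx.
  exists (p (f (RtoC x))). apply real_functional_pseries; trivial.
  apply ha. rewrite Cmod_R, Rabs_pos_eq; lra.
Qed.

(** The moduli are majorized by |Re| + |Im|, and each of these gives an absolutely convergent Cauchy
    product of real series with radius at least 1. *)
Lemma ex_series_Cmod_Stheta (theta : R) (a : nat -> C) (f : C -> C) (x : R) :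
  0 < theta -> analytic_in_disc a f -> 0 <= x < 1 ->
  ex_series (fun i => Cmod (Stheta theta a (S i)) * x ^ i).
Proof.
  intros ht ha hx.
  assert (hp : forall p, real_functional p ->
    ex_series (fun i => Rabs (p (Stheta theta a (S i)) * x ^ i))).
  { intros p hp.
    apply ex_series_ext with (fun i => Rabs
      (PS_mult (PS_derive (fun k => p (a k))) (gbinom theta) i * x ^ i)).
    - intros i. now rewrite Stheta_real_functional.
    - apply CV_disk_inside, lt_CV_radius; trivial.
      apply CV_radius_mult_ge_1; [|now apply CV_radius_gbinom].
      rewrite CV_radius_derive. now apply CV_radius_real_functional with f. }
  apply (ex_series_le (V := R_CompleteNormedModule) _
    (fun i => Rabs (Re (Stheta theta a (S i)) * x ^ i)
            + Rabs (Im (Stheta theta a (S i)) * x ^ i))).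
  - intros i. pose proof (pow_le x i (proj1 hx)) as hxi.
    change (Rabs (Cmod (Stheta theta a (S i)) * x ^ i)
      <= Rabs (Re (Stheta theta a (S i)) * x ^ i)
         + Rabs (Im (Stheta theta a (S i)) * x ^ i)).
    rewrite !Rabs_mult, !(Rabs_pos_eq (x ^ i)), Rabs_pos_eq, <- Rmult_plus_distr_r
      by (trivial; apply Cmod_ge_0).
    apply Rmult_le_compat_r; trivial. apply Cmod_le_Re_Im.
  - apply (ex_series_plus (V := R_NormedModule)
      (fun i => Rabs (Re (Stheta theta a (S i)) * x ^ i))
      (fun i => Rabs (Im (Stheta theta a (S i)) * x ^ i)));
      apply hp; [apply real_functional_Re | apply real_functional_Im].
Qed.

Theorem theorem1p1 (theta : R) (htheta : 0 < theta) :
  exists K : R, 0 < K /\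
    forall (a : nat -> C) (f : C -> C), analytic_in_disc a f ->
    forall n : nat, (1 <= n)%nat ->
      Cmod (cesaro_mean theta a n
            - f (RtoC (exp (- (1 / INR n))))
            - Stheta theta a n / RtoC (INR n * gbinom theta n))%C
      <= K * (1 / INR n *
                Series_from 1 (fun j =>
                  Cmod (Stheta theta a j) / Rpower (INR j) theta
                  * exp (- (INR j / INR n)))
              + 1 / Rpower (INR n) theta *
                Series_from n (fun j =>
                  Cmod (Stheta theta a j) / INR j
                  * exp (- (INR j / INR n)))).
Proof.
  destruct (real_bound theta htheta) as [K [hK hreal]].
  (* One [K] for the real part and one for the imaginary part. *)
  exists (2 * K). split; [lra|].
  intros a f ha n hn.
  set (r := exp (- (1 / INR n))).
  assert (hr : 0 <= r < 1).
  { split; [left; apply exp_pos|]. rewrite <- exp_0. apply exp_increasing.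
    assert (0 < 1 / INR n); [|lra].
    apply Rdiv_lt_0_compat; [lra | apply lt_0_INR; lia]. }
  (* The statement subtracts f before the correction term; additivity of [p] allows the two to be
     swapped, so that the corrected mean appears. *)
  assert (hp : forall p z, real_functional p ->
    z = (cesaro_mean theta a n - f (RtoC r)
         - Stheta theta a n / RtoC (INR n * gbinom theta n))%C ->
    p z = corrected_mean theta (fun k => p (a k)) n - PSeries (fun k => p (a k)) r).
  { intros p z hp ->.
    rewrite <- corrected_mean_real_functional by easy.
    rewrite (is_pseries_unique _ _ (p (f (RtoC r)))).
    - rewrite !real_functional_minus by easy. ring.
    - apply real_functional_pseries; trivial.
      apply ha. rewrite Cmod_R, Rabs_pos_eq; lra. }
  assert (hb : forall p, real_functional p ->
    Rabs (corrected_mean theta (fun k => p (a k)) n - PSeries (fun k => p (a k)) r)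
    <= K * (1 / INR n *
                Series_from 1 (fun j =>
                  Cmod (Stheta theta a j) / Rpower (INR j) theta
                  * exp (- (INR j / INR n)))
              + 1 / Rpower (INR n) theta *
                Series_from n (fun j =>
                  Cmod (Stheta theta a j) / INR j
                  * exp (- (INR j / INR n))))).
  { intros p h. apply hreal; trivial.
    - now apply CV_radius_real_functional with f.
    - intros i. rewrite <- Stheta_real_functional by easy. now apply h.
    - intros x hx. now apply ex_series_Cmod_Stheta with f. }
  eapply Rle_trans; [apply Cmod_le_Re_Im|].
  rewrite (hp Re _ real_functional_Re eq_refl), (hp Im _ real_functional_Im eq_refl).
  pose proof (hb Re real_functional_Re).
  pose proof (hb Im real_functional_Im).
  lra.
Qed.
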